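(* Suppose $H$ is a skew Hadamard matrix of order $m > 2$, and let $A$ be its core adjacency matrix. Let $$\alpha = -\frac{1}{\sqrt{m}} + i\sqrt{1 - \frac{1}{m}} \qquad \text{and} \qquad \beta = -\frac{2}{\sqrt{m}} + i\sqrt{1 - \frac{4}{m}}.$$ Then $$\Sigma = \begin{bmatrix} \alpha A + \overline{\alpha} A^\top & \alpha A + \overline{\alpha} A^\top + \beta I \\ \alpha A + \overline{\alpha} A^\top + \overline{\beta} I & -\alpha A - \overline{\alpha} A^\top \end{bmatrix}$$ is the signature matrix of a complex ETF of size $(m-1) \times 2(m-1)$.
   Context: A Hadamard matrix of order $m$ is an $m \times m$ matrix $H$ with entries in $\{1,-1\}$ satisfying $H^\top H = mI$. A skew Hadamard matrix is a Hadamard matrix of the form $H = C + I$ with $C^\top = -C$. (A skew Hadamard matrix of order $m$ exists only if $m = 1$, $m = 2$, or $4 \mid m$.) If $H$ is a skew Hadamard matrix and $D$ is a diagonal matrix with diagonal entries $\pm 1$, then $DHD$ is also a skew Hadamard matrix; the normalization of $H$ is the unique such $DHD$ whose top row consists entirely of $+1$ entries. For a skew Hadamard matrix $H$ of order $m > 1$, write its normalization as a block array $$\begin{bmatrix} 1 & \mathbf{1}^\top \\ -\mathbf{1} & A - A^\top + I \end{bmatrix},$$ where $\mathbf{1}$ is a column vector of ones and $A$ is a $(0,1)$-matrix of order $m-1$ with zero diagonal. Then $A$ is called the core adjacency matrix of $H$ (it records the off-diagonal locations of $+1$ in the lower-right block). For $n > d \geq 1$, an equiangular tight frame (ETF) of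 size $d \times n$ is a matrix $F = [f_1 \cdots f_n] \in \mathbb{C}^{d \times n}$ with unit-norm columns such that (i) $|f_i^* f_j| = \mu$ for all $i \neq j$, where $\mu = \sqrt{\frac{n-d}{d(n-1)}}$, and (ii) $FF^* = \frac{n}{d} I$. Its signature matrix is the $n \times n$ matrix $S = \frac{1}{\mu}(F^*F - I)$. *)

(* Defs.v *)
From mathcomp Require Import all_boot all_order all_algebra.
From mathcomp Require Import reals complex.

Set Implicit Arguments.
Unset Strict Implicit.
Unset Printing Implicit Defensive.

Import Order.TTheory GRing.Theory Num.Theory.
Local Open Scope ring_scope.
Local Open Scope sesquilinear_scope.

Definition is_hadamard (K : nzRingType) (m : nat) (H : 'M[K]_m) : Prop :=
  (forall i j, H i j = 1 \/ H i j = -1) /\ H^T *m H = m%:R%:M.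

Definition is_skew_hadamard (K : nzRingType) (m : nat) (H : 'M[K]_m) : Prop :=
  is_hadamard H /\ exists C : 'M[K]_m, H = C + 1%:M /\ C^T = - C.

(* N = D H D with D = diag d. For a skew Hadamard H over a field, d is
   determined up to a global sign, so N is unique. *)
Definition is_normalization (K : nzRingType) (k : nat)
    (H N : 'M[K]_(1 + k)) : Prop :=
  exists d : 'rV[K]_(1 + k),
    [/\ forall i, d 0 i = 1 \/ d 0 i = -1,
        N = diag_mx d *m H *m diag_mx d
      & forall j, N 0 j = 1].

(* When 1 != -1, H determines A: off the diagonal, an entry of A - A^T is 1 or
   -1 according to the value of A there.
   Orders are written [1 + k], so that the core has order [k] and block
   decompositions of the normalization need no cast. *)
Definition is_core_adjacency (K : nzRingType) (k : nat)
    (H : 'M[K]_(1 + k)) (A : 'M[K]_k) : Prop :=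
  [/\ forall i j, A i j = 0 \/ A i j = 1,
      forall i, A i i = 0
    & is_normalization H
        (block_mx (1%:M : 'M_1)      (const_mx 1)
                  (- const_mx 1)     (A - A^T + 1%:M))].

Section Frames.
Variable C : numClosedFieldType.

Definition l2norm (d : nat) (v : 'cV[C]_d) : C :=
  sqrtC (\sum_i `|v i 0| ^+ 2).

Definition etf_mu (d n : nat) : C :=
  sqrtC ((n%:R - d%:R) / (d%:R * (n%:R - 1))).

Definition is_etf (d n : nat) (F : 'M[C]_(d, n)) : Prop :=
  [/\ (1 <= d < n)%N,
      forall j, l2norm (col j F) = 1,
      forall i j, i != j ->
        `|((col i F)^t* *m col j F) 0 0| = etf_mu d n
    & F *m F^t* = (n%:R / d%:R)%:M].

Definition signature_matrix (d n : nat) (F : 'M[C]_(d, n)) : 'M[C]_n :=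
  (etf_mu d n)^-1 *: (F^t* *m F - 1%:M).

End Frames.

(* Main.v *)
Require Import Defs.
From mathcomp Require Import all_boot all_order all_algebra.
From mathcomp Require Import reals complex.
From mathcomp Require Import ring.

(** Call a matrix Sigma of even order n = 2d a conference matrix if it is
    Hermitian, has zero diagonal and unimodular off-diagonal entries, and
    satisfies Sigma^2 = (n - 1) I. Such a matrix is the signature matrix of an
    ETF of size d x n ([conference_etf]): with mu = (n - 1)^(-1/2), the matrix
    P = (I + mu Sigma) / 2 is an orthogonal projection, and its trace, hence
    its rank, is d because Sigma has zero trace. Writing P = V^* V for a d x n
    matrix V with orthonormal rows, the columns of F = sqrt(2) V have Gram
    matrix I + mu Sigma, which has 1 on the diagonal and entries of modulus mu
    off it, and F F^* = 2 I.

    So it suffices to see that the block matrix built from A is a conference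
    matrix of order 2k, where k = m - 1. Put B = A - A^T and let J be the
    all-ones matrix. The Hadamard property of the normalization says that
    A + A^T = J - I ([core_add_tr]) and that J B = 0 and B^2 = J - k I
    ([core_gram]): A is a doubly regular tournament. With
    S = alpha A + conj(alpha) A^T and p = alpha + conj(alpha), this gives
    2 S = p (J - I) + (alpha - conj(alpha)) B, and since |alpha| = 1 and
    p^2 m = 4, the coefficient of J in S^2 + p S vanishes:
    S^2 + p S = (k - 1) I ([seidel_quadratic]). The blocks of Sigma all commute;
    the off-diagonal blocks of Sigma^2 therefore cancel, and its diagonal blocks
    are 2 S^2 + (beta + conj(beta)) S + |beta|^2 I, which is (2k - 1) I because
    beta + conj(beta) = 2 p and |beta| = 1.

    The number beta is unimodular only when 4 <= m, so order 3 has to be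
    excluded. The column sums of A are all equal to (k - 1) / 2, which forces k
    to be odd ([core_order_odd]). *)

Import Order.TTheory GRing.Theory Num.Theory.
Local Open Scope ring_scope.

(** * From conference matrices to equiangular tight frames *)

Section ConferenceFrames.
Local Open Scope sesquilinear_scope.
Variable C : numClosedFieldType.

Lemma adjmxM m n p (A : 'M[C]_(m, n)) (B : 'M[C]_(n, p)) :
  (A *m B)^t* = B^t* *m A^t*.
Proof. by rewrite trmx_mul map_mxM. Qed.

Lemma adjmxK m n (A : 'M[C]_(m, n)) : (A^t*)^t* = A.
Proof. by apply/matrixP => i j; rewrite !mxE conjCK. Qed.

(** The rows of V are an orthonormal basis of the row space of P. Then V^* V is
    the orthogonal projection onto that space, and it is equal to P since P is
    Hermitian. *)
Lemma projection_factor n (P : 'M[C]_n) : P^t* = P -> P *m P = P ->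
  exists V : 'M[C]_(\rank P, n), V *m V^t* = 1%:M /\ V^t* *m V = P.
Proof.
move=> Padj Pidem; pose V := schmidt (row_base P).
have Vunit : V *m V^t* = 1%:M.
  by apply/unitarymxP/schmidt_unitarymx; rewrite rank_leq_col.
have VP : (V :=: P)%MS.
  by apply: eqmx_trans (eqmx_schmidt_free (row_base_free P)) (eq_row_base P).
exists V; split=> //.
have /submxP[D PE] : (P <= V)%MS by rewrite VP.
have /submxP[E VE] : (V <= P)%MS by rewrite VP.
have fixP : P *m (V^t* *m V) = P.
  by rewrite {1}PE -mulmxA [V *m _]mulmxA Vunit mul1mx -PE.
have fixV : V *m P = V by rewrite VE -mulmxA Pidem.
have -> : V^t* *m V = (P *m (V^t* *m V))^t*.
  by rewrite !adjmxM adjmxK Padj -mulmxA fixV.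
by rewrite fixP Padj.
Qed.

(** The trace of an orthogonal projection is its rank, by cyclicity of the trace
    applied to V^* V and V V^* = I. *)
Lemma projection_frame d n (P : 'M[C]_n) :
    P^t* = P -> P *m P = P -> \tr P = d%:R ->
  exists V : 'M[C]_(d, n), V *m V^t* = 1%:M /\ V^t* *m V = P.
Proof.
move=> Padj Pidem trP; have [V [VV1 VVP]] := projection_factor _ P Padj Pidem.
have <- : \rank P = d; last by exists V.
apply/eqP; rewrite -(eqr_nat C) -trP -[in eqbRHS]VVP.
by rewrite mxtrace_mulC VV1 mxtrace1 eqxx.
Qed.

(** For n = 2d the parameter mu of the frame is (n - 1)^(-1/2), which is exactly
    the scaling that makes (mu S)^2 = I, so that (I + mu S) / 2 is
    idempotent. *)
Lemma conference_etf d (S : 'M[C]_(d + d)) : (0 < d)%N ->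
    S^t* = S -> (forall i, S i i = 0) ->
    (forall i j, i != j -> `|S i j| = 1) ->
    S *m S = ((d + d)%:R - 1)%:M ->
  exists F : 'M[C]_(d, d + d), is_etf F /\ S = signature_matrix F.
Proof.
move=> d_gt0 Sadj Sdiag Soff Ssq.
have d_neq0 : d%:R != 0 :> C by rewrite pnatr_eq0 -lt0n.
set w : C := (d + d)%:R - 1 in Ssq *.
have w_gt0 : 0 < w by rewrite subr_gt0 ltr1n (leq_add d_gt0 d_gt0).
have muE : etf_mu C d (d + d) = sqrtC w^-1.
  rewrite /etf_mu; congr sqrtC; rewrite -/w natrD addrK.
  by rewrite invfM mulrA mulfV ?mul1r.
set mu := etf_mu C d (d + d) in muE *.
have mu_ge0 : 0 <= mu by rewrite muE sqrtC_ge0 invr_ge0 ltW.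
have mu_sq : mu * mu = w^-1 by rewrite -expr2 muE sqrtCK.
have mu_neq0 : mu != 0 by rewrite muE sqrtC_eq0 invr_eq0 gt_eqF.
have mu_conj : mu^* = mu by apply/CrealP; rewrite realE mu_ge0.
pose P := 2^-1 *: (1%:M + mu *: S).
have [||| V [VV1 VVP]] := @projection_frame d _ P.
- rewrite /P; apply/matrixP => i j; rewrite !mxE.
  have /matrixP/(_ i j) := Sadj; rewrite !mxE => SE.
  rewrite rmorphM fmorphV /= conjC_nat rmorphD rmorphM /= mu_conj SE.
  by rewrite conjC_nat eq_sym.
- rewrite /P -scalemxAl -scalemxAr mulmxDl !mulmxDr !mul1mx mulmx1.
  rewrite -scalemxAl -!scalemxAr Ssq.
  apply/matrixP => i j; rewrite !mxE; set s := S i j.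
  case: (i == j); rewrite ?mulr1n ?mulr0n; last by field.
  have -> : mu * (mu * w) = 1 by rewrite mulrA mu_sq mulVf ?gt_eqF.
  by field.
- rewrite /P mxtraceZ mxtraceD mxtrace1 mxtraceZ /mxtrace big1 // mulr0 addr0.
  by rewrite natrD; field.
pose F := sqrtC 2 *: V.
have s2 : sqrtC 2 * sqrtC 2 = 2 :> C by rewrite -expr2 sqrtCK.
have Fadj : F^t* = sqrtC 2 *: V^t*.
  have s2C : (sqrtC 2 : C)^* = sqrtC 2.
    by apply/CrealP; rewrite realE sqrtC_ge0 ler0n.
  by apply/matrixP => i j; rewrite !mxE rmorphM /= s2C.
have GramE : F^t* *m F = 1%:M + mu *: S.
  rewrite Fadj -scalemxAl -scalemxAr scalerA s2 VVP /P scalerA.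
  by rewrite mulfV ?scale1r // pnatr_eq0.
have GramEij i j : ((col i F)^t* *m col j F) 0 0 = (i == j)%:R + mu * S i j.
  have /matrixP/(_ i j) := GramE; rewrite !mxE => <-.
  by apply: eq_bigr => l _; rewrite !mxE.
exists F; split; last first.
  by rewrite /signature_matrix GramE addrC addKr scalerA mulVf ?scale1r.
split.
- by rewrite d_gt0 -[X in (X < _)%N]addn0 ltn_add2l.
- move=> j; rewrite /l2norm; transitivity (sqrtC 1 : C); last exact: sqrtC1.
  congr sqrtC; transitivity (((col j F)^t* *m col j F) 0 0).
    by rewrite mxE; apply: eq_bigr => l _; rewrite !mxE normCKC.
  by rewrite GramEij eqxx Sdiag mulr0 addr0.
- move=> i j ij; rewrite GramEij (negPf ij) add0r normrM Soff // mulr1.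
  by rewrite ger0_norm.
- rewrite Fadj -scalemxAl -scalemxAr scalerA s2 VV1 scalemx1.
  by congr (_%:M); rewrite natrD mulrDl mulfV.
Qed.

End ConferenceFrames.

(** * The core of a normalized Hadamard matrix *)

Lemma const_mx1M (K : pzRingType) m n p :
  (const_mx 1 : 'M[K]_(m, n)) *m const_mx 1
    = n%:R *: (const_mx 1 : 'M[K]_(m, p)).
Proof.
apply/matrixP => i j; rewrite !mxE mulr1.
by under eq_bigr do rewrite !mxE mulr1; rewrite sumr_const card_ord.
Qed.

Lemma normalization_hadamard (K : comNzRingType) k (H N : 'M[K]_(1 + k)) :
  is_hadamard H -> is_normalization H N -> is_hadamard N.
Proof.
move=> [H1 HH] [d [d1 NE _]]; split=> [i j|].
  rewrite NE mul_mx_diag mul_diag_mx !mxE.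
  by case: (d1 i) (d1 j) (H1 i j) => -> [] -> [] ->;
    rewrite ?(mulrN1, mulN1r, mulr1, opprK); auto.
have dd : diag_mx d *m diag_mx d = 1%:M.
  rewrite mulmx_diag -diag_const_mx; congr diag_mx; apply/rowP => i.
  by rewrite !mxE; case: (d1 i) => ->; rewrite ?mulrNN mulr1.
rewrite NE !trmx_mul tr_diag_mx !mulmxA -[_ *m diag_mx d *m diag_mx d]mulmxA dd.
rewrite mulmx1 -[_ *m H^T *m H]mulmxA HH mul_mx_scalar -scalemxAl dd.
by rewrite scalemx1.
Qed.

Section Tournament.
Variables (K : numFieldType) (k : nat) (A : 'M[K]_k).
Hypothesis A01 : forall i j, A i j = 0 \/ A i j = 1.
Hypothesis Adiag : forall i, A i i = 0.
Hypothesis Nhad : is_hadamard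
  (block_mx (1%:M : 'M_1) (const_mx 1) (- const_mx 1) (A - A^T + 1%:M)).
Local Notation J := (const_mx 1 : 'M[K]_k).
Local Notation B := (A - A^T).

(** Off the diagonal, A i j - A j i is an entry of a Hadamard matrix, hence
    nonzero: A is the adjacency matrix of a tournament. *)
Lemma core_entries i j : i != j ->
  (A i j = 0 /\ A j i = 1) \/ (A i j = 1 /\ A j i = 0).
Proof.
move=> ij; case: Nhad => /(_ (rshift 1 i) (rshift 1 j)) + _.
rewrite block_mxEdr !mxE (negPf ij) addr0.
case: (A01 i j) (A01 j i) => -> [] ->; rewrite ?subr0 ?sub0r ?subrr; auto.
all: by case=> /eqP; rewrite eq_sym ?oppr_eq0 oner_eq0.
Qed.

Lemma core_add_tr : A + A^T = J - 1%:M.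
Proof.
apply/matrixP => i j; rewrite !mxE; have [->|ij] := eqVneq i j.
  by rewrite !Adiag addr0 subrr.
rewrite subr0; case: (core_entries i j ij) => -[-> ->]; first exact: add0r.
exact: addr0.
Qed.

Lemma core_tr_skew : B^T = - B.
Proof. by rewrite linearB /= trmxK opprB. Qed.

(** These are the upper right and lower right blocks of N^T N = (1 + k) I, where
    N is the bordered matrix; as B is skew-symmetric, the product of
    (B + I)^T and B + I is I - B^2. *)
Lemma core_gram :
  J *m B = 0 /\ B *m B = J - k%:R%:M.
Proof.
case: Nhad => _; rewrite tr_block_mx mulmx_block scalar_mx_block.
have -> : (B + 1%:M)^T = 1%:M - B.
  by rewrite linearD /= core_tr_skew tr_scalar_mx addrC.
have -> : (- const_mx 1 : 'M[K]_(k, 1))^T = - const_mx 1.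
  by rewrite linearN /= trmx_const.
rewrite tr_scalar_mx trmx_const => /eq_block_mx[_ colB _ gramB].
have JB : J *m B = 0.
  have -> : J = (const_mx 1 : 'M_(k, 1)) *m (const_mx 1 : 'M_(1, k)).
    by rewrite const_mx1M scale1r.
  move/eqP: colB; rewrite mul1mx mulNmx mulmxDr mulmx1 addrC opprD addrNK.
  by rewrite oppr_eq0 -mulmxA => /eqP ->; rewrite mulmx0.
split=> //; move: gramB.
rewrite const_mx1M scale1r mulmxBl mul1mx mulmxDr mulmx1.
move: (B *m B) => X /matrixP gramB; apply/matrixP => i j.
move: (gramB i j); rewrite !mxE natrD.
move=> /eqP; rewrite -subr_eq0 -oppr_eq0 => /eqP gramBij.
apply: subr0_eq; rewrite -gramBij.
by case: (i == j); rewrite ?mulr1n ?mulr0n; ring.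
Qed.

(** Since J B = 0, column j of A has the same sum c as row j, and together they
    have sum k - 1 because A + A^T = J - I. As A has entries 0 and 1, c is a
    natural number, and k = 2c + 1. *)
Lemma core_order_odd : (0 < k)%N -> odd k.
Proof.
move=> k_gt0; pose j := Ordinal k_gt0.
pose c := (\sum_i (A i j == 1)%R)%N.
have sumA : \sum_i A i j = c%:R.
  rewrite natr_sum; apply: eq_bigr => i _.
  by case: (A01 i j) => ->; rewrite ?eqxx // eq_sym oner_eq0.
have sumB : \sum_i A i j = \sum_i A j i.
  have [/matrixP/(_ j j) + _] := core_gram; rewrite !mxE => sumB0.
  apply/eqP; rewrite -subr_eq0 -sumrB; apply/eqP; rewrite -[RHS]sumB0.
  by apply: eq_bigr => i _; rewrite !mxE mul1r.
have sumD : \sum_i A i j + \sum_i A j i = k%:R - 1.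
  rewrite -big_split /=.
  transitivity (\sum_(i < k) (1 - (i == j)%:R) : K).
    apply: eq_bigr => i _.
    by have /matrixP/(_ i j) := core_add_tr; rewrite !mxE.
  rewrite sumrB sumr_const card_ord (bigD1 j) //= big1 ?addr0 //.
  by move=> i /negPf ->.
have kE : k = (c + c).+1.
  by apply/eqP; rewrite -(eqr_nat K) -addn1 !natrD -sumA {2}sumB sumD subrK.
by rewrite kE addnn /= odd_double.
Qed.

End Tournament.

(** * The block matrix is a conference matrix *)

Section Signature.
Local Open Scope sesquilinear_scope.
Variables (C : numClosedFieldType) (k : nat) (A : 'M[C]_k) (alpha beta : C).
Hypothesis A01 : forall i j, A i j = 0 \/ A i j = 1.
Hypothesis Adiag : forall i, A i i = 0.
Hypothesis Nhad : is_hadamard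
  (block_mx (1%:M : 'M_1) (const_mx 1) (- const_mx 1) (A - A^T + 1%:M)).
Hypothesis alpha1 : alpha * alpha^* = 1.
Hypothesis beta1 : beta * beta^* = 1.
Hypothesis alphaRe : (alpha + alpha^*) ^+ 2 * (1 + k%:R) = 4.
Hypothesis betaRe : beta + beta^* = 2 * (alpha + alpha^*).

Local Notation S := (alpha *: A + alpha^* *: A^T).
Local Notation Sigma :=
  (block_mx S (S + beta%:M) (S + (beta^*)%:M) (- S)).

(** The products of J and B are known: J^2 = k J, J B = B J = 0 and
    B^2 = J - k I. In S^2 + p S the terms in B cancel, and the coefficient of J
    is (p^2 (1 + k) - 4) / 4, which is 0 by the choice of the real part of
    alpha. *)
Lemma seidel_quadratic :
  S *m S + (alpha + alpha^*) *: S = (k%:R - 1)%:M.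
Proof.
set p := alpha + alpha^*; pose q := alpha - alpha^*.
pose J := const_mx 1 : 'M[C]_k; pose B := A - A^T.
have SE : S = 2^-1 *: (p *: (J - 1%:M) + q *: B).
  rewrite -(core_add_tr _ _ _ A01 Adiag Nhad) /B /p /q.
  by apply/matrixP => i j; rewrite !mxE; field.
have [JB BB] := core_gram _ _ _ Nhad; rewrite -/J -/B in JB BB.
have BJ : B *m J = 0.
  apply: oppr_inj; rewrite oppr0 -mulNmx -core_tr_skew -[J]trmx_const.
  by rewrite -trmx_mul JB trmx0.
have JJ : J *m J = k%:R *: J by rewrite const_mx1M.
have q2 : q * q = p ^+ 2 - 4.
  have -> : q * q = p ^+ 2 - 4 * (alpha * alpha^*) by rewrite /p /q; ring.
  by rewrite alpha1 mulr1.
have Jij i j : J i j = 1 by rewrite mxE.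
have pk : p ^+ 2 * (1 + k%:R) = 4 by [].
clearbody J B p q.
rewrite SE -scalemxAl -scalemxAr !(mulmxDl, mulmxDr, mulmxN, mulNmx).
rewrite -!(scalemxAl, scalemxAr) !(mulmxDl, mulmxDr, mulmxN, mulNmx).
rewrite JJ JB BJ BB !(mulmx1, mul1mx).
apply/matrixP => i j.
(* Only the entries off the diagonal need the value of p ^+ 2 * (1 + k). *)
rewrite !mxE Jij ![q * (q * _)]mulrA q2.
have [_|_] := eqVneq i j; rewrite ?mulr1n ?mulr0n; first by field.
transitivity ((p ^+ 2 * (1 + k%:R) - 4) / 4); first by field.
by rewrite pk subrr mul0r.
Qed.

Lemma seidel_adj : S^t* = S.
Proof.
have Aconj i j : (A i j)^* = A i j.
  by case: (A01 i j) => ->; rewrite ?conjC0 ?conjC1.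
apply/matrixP => i j; rewrite !mxE rmorphD !rmorphM /= conjCK !Aconj.
by rewrite addrC.
Qed.

Lemma signature_adj : Sigma^t* = Sigma.
Proof.
have adjD (c : C) : (S + c%:M)^t* = S + (c^*)%:M.
  by rewrite linearD map_mxD /= seidel_adj tr_scalar_mx map_scalar_mx.
rewrite tr_block_mx map_block_mx !adjD conjCK seidel_adj.
by rewrite linearN map_mxN /= seidel_adj.
Qed.

Lemma signature_diag i : Sigma i i = 0.
Proof.
have Sii j : S j j = 0 by rewrite !mxE Adiag !mulr0 addr0.
case: (split_ordP i) => j ->; rewrite ?block_mxEul ?block_mxEdr ?Sii //.
by rewrite mxE Sii oppr0.
Qed.

Lemma signature_unimodular i j : i != j -> `|Sigma i j| = 1.
Proof.
have norm1 (c : C) : c * c^* = 1 -> `|c| = 1.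
  by move=> c1; apply/eqP; rewrite -(@pexpr_eq1 _ _ 2) // normCK c1.
have normS i' j' : i' != j' -> `|S i' j'| = 1.
  move=> ij; rewrite !mxE; case: (core_entries _ _ _ A01 Nhad i' j' ij).
    by case=> -> ->; rewrite mulr0 add0r mulr1 norm_conjC norm1.
  by case=> -> ->; rewrite mulr0 addr0 mulr1 norm1.
have Sii i' : S i' i' = 0 by rewrite !mxE Adiag !mulr0 addr0.
have normSD (c : C) i' j' : c * c^* = 1 -> `|(S + c%:M) i' j'| = 1.
  move=> c1; rewrite mxE [c%:M i' j']mxE.
  have [->|ij] := eqVneq i' j'; first by rewrite Sii add0r mulr1n norm1.
  by rewrite addr0 normS.
case: (split_ordP i) (split_ordP j) => i' -> [] j' ->.
- by rewrite block_mxEul (inj_eq (@lshift_inj _ _)); exact: normS.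
- by rewrite block_mxEur normSD.
- by rewrite block_mxEdl normSD // conjCK mulrC.
- rewrite block_mxEdr (inj_eq (@rshift_inj _ _)) [(- S) i' j']mxE normrN.
  exact: normS.
Qed.

(** All blocks are polynomials in S, so the off-diagonal blocks of the square
    cancel; on the diagonal, beta + beta^* = 2 (alpha + alpha^* ) turns the sum
    into twice the left-hand side of [seidel_quadratic] plus |beta|^2 I. *)
Lemma signature_sqr : Sigma *m Sigma = ((k + k)%:R - 1)%:M.
Proof.
have quad := seidel_quadratic.
rewrite mulmx_block; move: quad; move: S => X quad.
have pE : alpha + alpha^* = (beta + beta^*) / 2 by rewrite betaRe; field.
have XX : X *m X = (k%:R - 1)%:M - (alpha + alpha^*) *: X.
  by rewrite -quad addrK.
rewrite !(mulmxDl, mulmxDr, mulmxN, mulNmx, mul_mx_scalar, mul_scalar_mx) XX.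
rewrite scalar_mx_block; congr block_mx; apply/matrixP => i j; rewrite !mxE.
1,4: rewrite natrD pE; case: (i == j); rewrite ?mulr1n ?mulr0n.
all: rewrite ?mulr0 ?[beta^* * beta]mulrC ?beta1; by [field | ring].
Qed.

End Signature.

(** * Skew Hadamard matrices *)

Theorem corollary14 (R : realType) (k : nat) (hm : (2 < 1 + k)%N)
    (H : 'M[R[i]]_(1 + k)) (hH : is_skew_hadamard H)
    (A : 'M[R[i]]_k) (hA : is_core_adjacency H A) :
  let m : R := (1 + k)%:R in
  let alpha : R[i] := (- (1 / Num.sqrt m) +i* Num.sqrt (1 - 1 / m))%C in
  let beta : R[i] := (- (2 / Num.sqrt m) +i* Num.sqrt (1 - 4 / m))%C in
  let Sigma : 'M[R[i]]_(k + k) :=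
    block_mx (alpha *: A + alpha^* *: A^T)
             (alpha *: A + alpha^* *: A^T + beta%:M)
             (alpha *: A + alpha^* *: A^T + (beta^*)%:M)
             (- (alpha *: A) - alpha^* *: A^T) in
  exists F : 'M[R[i]]_(k, k + k),
    is_etf F /\ Sigma = signature_matrix F.
Proof.
move=> m alpha beta Sigma.
have [[Hhad _] [A01 Adiag normA]] := (hH, hA).
have Nhad := normalization_hadamard _ _ _ _ Hhad normA.
have k_odd : odd k by apply: core_order_odd A01 Adiag Nhad _; exact: ltnW.
have m_ge4 : 4 <= m.
  rewrite /m ler_nat (ltn_neqAle 3) hm andbT.
  (* Only the order 1 + k = 3 remains to be excluded; there k is even. *)
  by apply: contraTneq k_odd; rewrite add1n => -[<-].
have m_gt0 : 0 < m by apply: lt_le_trans m_ge4.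
have sm2 : Num.sqrt m ^+ 2 = m by rewrite sqr_sqrtr // ltW.
have addJ (z : R[i]) : z + z^* = 2 * (complex.Re z)%:C%C by exact: addcJ.
have sm_neq0 : Num.sqrt m != 0 by rewrite gt_eqF // sqrtr_gt0.
have unit_circle (c : R) : c ^+ 2 <= m ->
    let z : R[i] := (- (c / Num.sqrt m) +i* Num.sqrt (1 - c ^+ 2 / m))%C in
    z * z^* = 1.
  move=> c_le z; rewrite -normCK -add_Re2_Im2 /= sqrrN expr_div_n sm2.
  by rewrite sqr_sqrtr ?subr_ge0 ?ler_pdivrMr ?mul1r // addrC subrK.
have alpha1 : alpha * alpha^* = 1.
  have := unit_circle 1; rewrite expr1n; apply.
  by apply: le_trans m_ge4; rewrite ler1n.
have beta1 : beta * beta^* = 1.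
  by have := unit_circle 2; rewrite -natrX; apply.
have betaRe : beta + beta^* = 2 * (alpha + alpha^*).
  rewrite !addJ -(rmorph_nat (real_complex R) 2) -!rmorphM /=.
  by congr (_%:C%C); field.
have alphaRe : (alpha + alpha^*) ^+ 2 * (1 + k%:R) = 4.
  rewrite addJ -(natrD _ 1 k) -!(rmorph_nat (real_complex R)).
  rewrite -rmorphM -rmorphXn -rmorphM /= -/m.
  by congr (_%:C%C); rewrite -[X in _ * X = _]sm2; field.
have SigmaE : Sigma = block_mx
   (alpha *: A + alpha^* *: A^T) (alpha *: A + alpha^* *: A^T + beta%:M)
   (alpha *: A + alpha^* *: A^T + (beta^*)%:M)
   (- (alpha *: A + alpha^* *: A^T)) by rewrite opprD.
rewrite SigmaE; apply: conference_etf.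
- exact: ltnW.
- exact: signature_adj.
- exact: signature_diag.
- exact: signature_unimodular.
- exact: signature_sqr.
Qed.
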